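(* There exists a positive absolute constant $C$ such that for every compact $\Omega\subset\mathbb{R}^d$, every integer $n\ge2$, every linear subspace $X_n$ of $\mathcal{C}(\Omega)$ of dimension at most $n$, every $\varepsilon\in(0,1)$ and every probability measure $\mu$ on $\Omega$, there are a positive integer $m\le C\varepsilon^{-2}n\log n$, points $\xi^1,\dots,\xi^m\in\Omega$ and nonnegative weights $\lambda_1,\dots,\lambda_m$ such that for all $f\in X_n$ $$(1-\varepsilon)\|f\|_{L_1(\Omega,\mu)}\le\sum_{j=1}^m\lambda_j|f(\xi^j)|\le(1+\varepsilon)\|f\|_{L_1(\Omega,\mu)} .$$
   Context: $\mathcal{C}(\Omega)$ is the space of (real) continuous functions on $\Omega$, and $\|f\|_{L_1(\Omega,\mu)}=\int_\Omega|f|\,d\mu$, where $\mu$ is a Borel probability measure. $\log$ is the natural logarithm. ''Absolute constant'' means independent of all other data. *)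

(* Defs.v *)
From HB Require Import structures.
From mathcomp Require Export all_boot all_order all_algebra.
From mathcomp Require Export all_classical all_reals all_analysis.
Export numFieldNormedType.Exports.

Set Implicit Arguments.
Unset Strict Implicit.
Unset Printing Implicit Defensive.

Import Order.TTheory GRing.Theory Num.Theory.

Local Open Scope classical_set_scope.
Local Open Scope ring_scope.

(* A [measurableType] must be pointed, and the subtype associated with a set
   [A] has no canonical point; [subspace_at x0] is that subtype, with its
   subspace topology, pointed at [x0 : A]. *)
Definition subspace_at {T : topologicalType} {A : set T} (x0 : A) : Type := A.

HB.instance Definition _ {T : topologicalType} {A : set T} (x0 : A) :=
  Topological.copy (subspace_at x0) (A : Type).
HB.instance Definition _ {T : topologicalType} {A : set T} (x0 : A) :=
  isPointed.Build (subspace_at x0) x0.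

(* The sigma-algebra does not depend on [x0]. *)
Notation borelType x0 := (g_sigma_algebraType (@open (subspace_at x0))).

(* [vector.v] only treats subspaces of a finite-dimensional ambient space,
   whereas the ambient space here is a function space. *)
Definition lin_indep {K : fieldType} {V : lmodType K} {k : nat}
    (b : 'I_k -> V) : Prop :=
  forall c : 'I_k -> K, \sum_(i < k) c i *: b i = 0 -> forall i, c i = 0.

Definition is_basis {K : fieldType} {V : lmodType K} (X : {pred V}) {k : nat}
    (b : 'I_k -> V) : Prop :=
  [/\ forall i, b i \in X,
      lin_indep b &
      forall v, v \in X -> exists c : 'I_k -> K, v = \sum_(i < k) c i *: b i].

Definition dim_le {K : fieldType} {V : lmodType K} (X : {pred V}) (n : nat) :
    Prop :=
  exists k : nat, (k <= n)%N /\ exists b : 'I_k -> V, is_basis X b.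

(* Main.v *)
Require Import Defs.
From mathcomp Require Import finmap measurable_realfun ring lra zify.

(* The measure is first replaced by a finitely supported one.  With
   f_c = sum_i c_i b_i and G the Gram matrix of the b_i in L_2(mu), the
   coefficients c' = c G G^+ (G^+ a generalized inverse) give f_c' = f_c almost
   everywhere, and |c'_i| <= const * ||f_c||_1.  So on cells where every b_i
   oscillates little, f_c is constant up to a small multiple of ||f_c||_1.

   For a finite matrix A, approximate Lewis weights w (obtained by iterating
   w |-> sqrt(leverage), which halves logarithmic distances) give a reproducing
   kernel K for the column space with |K| <= 1, sum_j w_j K_ij^2 <= 1 and
   sum w = O(n).  Sample m rows independently with probabilities proportional
   to w.  After symmetrization and contraction, the uniform deviation over the
   unit ball of L_1 is bounded by the mean of
   sup_f sum_j s_j f(I_j) / (m q(I_j)) = sup_f sum_i f(i) t_i,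
   where the t_i are subgaussian with variance O(n / m).  Bounding
   lam |t_i| <= L + exp(lam |t_i| - L) and |f(i)| <= w_i replaces the maximum
   over the N rows by an average of total mass O(n), which is why log n
   appears and not log N. *)

Set Implicit Arguments.
Unset Strict Implicit.
Unset Printing Implicit Defensive.

Import Order.TTheory GRing.Theory Num.Theory.
Local Open Scope classical_set_scope.
Local Open Scope ring_scope.

(** * Lewis weights *)

(** Lagrange's identity: the difference of the two sides is half a double sum of weighted
    squares. *)
Lemma sum_cauchy_schwarz (R : realType) (T : finType) (r p q : T -> R) :
  (forall x, 0 <= r x) ->
  (\sum_x r x * (p x * q x)) ^+ 2 <=
  (\sum_x r x * p x ^+ 2) * (\sum_x r x * q x ^+ 2).
Proof.
move=> r_ge0; rewrite -subr_ge0.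
suff <- : 2^-1 * (\sum_x \sum_y r x * r y * (p x * q y - p y * q x) ^+ 2) =
    (\sum_x r x * p x ^+ 2) * (\sum_x r x * q x ^+ 2) -
    (\sum_x r x * (p x * q x)) ^+ 2.
  rewrite mulr_ge0 ?invr_ge0 ?ler0n// sumr_ge0// => x _.
  by rewrite sumr_ge0// => y _; rewrite mulr_ge0 ?sqr_ge0// mulr_ge0.
have -> : \sum_x \sum_y r x * r y * (p x * q y - p y * q x) ^+ 2 =
    \sum_x \sum_y (r x * p x ^+ 2) * (r y * q y ^+ 2) +
    \sum_x \sum_y (r x * q x ^+ 2) * (r y * p y ^+ 2) -
    2 * \sum_x \sum_y (r x * (p x * q x)) * (r y * (p y * q y)).
  rewrite mulr_sumr -!big_split/= -sumrB; apply: eq_bigr => x _.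
  rewrite mulr_sumr -!big_split/= -sumrB; apply: eq_bigr => y _.
  ring.
by rewrite -!big_distrlr/=; field.
Qed.

Section Leverage.
Variables (R : realType) (N k : nat) (A : 'M[R]_(N, k)).
Hypothesis A_full : row_full A.
Implicit Types w : 'I_N -> R.

Definition weight_mx w : 'M[R]_N := diag_mx (\row_i (w i)^-1).

Definition gram w : 'M[R]_k := A^T *m weight_mx w *m A.

(* [hat w *m weight_mx w] is the projection onto the column space of [A] that is
   orthogonal in [L_2] of the measure with masses [(w i)^-1]. *)
Definition hat w : 'M[R]_N := A *m invmx (gram w) *m A^T.

(** With [u = v A^T], the form [v *m gram w *m v^T] is the sum of the [u_j^2 / w_j]. If it vanishes
    then [u = 0], and [v = 0] because [A] has full column rank. *)
Lemma gram_unit w : (forall i, 0 < w i) -> gram w \in unitmx.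
Proof.
move=> w_gt0; rewrite -row_free_unit; apply: inj_row_free => v vG.
pose u : 'rV_N := v *m A^T.
have : (u *m weight_mx w *m u^T) 0 0 = 0.
  have -> : u *m weight_mx w *m u^T = v *m gram w *m v^T.
    by rewrite trmx_mul trmxK /u /gram !mulmxA.
  by rewrite vG mul0mx mxE.
rewrite /weight_mx mul_mx_diag !mxE => u0.
have {}u0 : u = 0.
  apply/rowP => i; rewrite [RHS]mxE.
  have {}u0 : \sum_j u 0 j ^+ 2 / w j = 0.
    by rewrite -[RHS]u0; apply: eq_bigr => j _; rewrite !mxE expr2 mulrAC.
  have /eqP := psumr_eq0P (fun j _ => divr_ge0 (sqr_ge0 (u 0 j)) (ltW (w_gt0 j)))
    u0 (i := i) isT.
  by rewrite mulf_eq0 invr_eq0 (gt_eqF (w_gt0 i)) orbF expf_eq0/= => /eqP.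
apply: trmx_inj; apply: (row_full_inj A_full).
by rewrite -(trmxK A) -trmx_mul -/u u0 !trmx0 mulmx0.
Qed.

Lemma hat_sym w : (hat w)^T = hat w.
Proof.
rewrite /hat /gram !trmx_mul trmx_inv !trmx_mul trmxK /weight_mx tr_diag_mx.
by rewrite !mulmxA.
Qed.

Lemma hat_symE w i j : hat w i j = hat w j i.
Proof. by rewrite -[in LHS](hat_sym w) mxE. Qed.

Lemma hat_reproducing w :
  (forall i, 0 < w i) -> hat w *m weight_mx w *m A = A.
Proof.
move=> w_gt0.
have -> : hat w *m weight_mx w *m A = A *m (invmx (gram w) *m gram w).
  by rewrite /hat [in _ *m gram w]/gram !mulmxA.
by rewrite mulVmx ?gram_unit// mulmx1.
Qed.

(** The reproducing property applied to the columns of [hat w'], which lie in the column space of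
    [A]. Allowing two different weights is what makes their kernels comparable. *)
Lemma hat_mul w w' i j : (forall i, 0 < w i) ->
  hat w' i j = \sum_y (w y)^-1 * (hat w i y * hat w' y j).
Proof.
move=> w_gt0; have {1}-> : hat w' = hat w *m weight_mx w *m hat w'.
  by rewrite {2}/hat !mulmxA hat_reproducing.
rewrite mxE; apply: eq_bigr => y _.
by rewrite /weight_mx mul_mx_diag !mxE; ring.
Qed.

Lemma hat_diag_ge0 w i : (forall i, 0 < w i) -> 0 <= hat w i i.
Proof.
move=> w_gt0; rewrite (hat_mul w i i w_gt0) sumr_ge0// => y _.
by rewrite hat_symE mulr_ge0 ?invr_ge0 ?(ltW (w_gt0 _))// -expr2 sqr_ge0.
Qed.

Lemma hat_diagE w i : (forall i, 0 < w i) ->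
  hat w i i = \sum_y (w y)^-1 * hat w i y ^+ 2.
Proof.
move=> w_gt0; rewrite (hat_mul w i i w_gt0); apply: eq_bigr => y _.
by rewrite (hat_symE w y i) expr2.
Qed.

Lemma sqr_hat_le w i j : (forall i, 0 < w i) ->
  hat w i j ^+ 2 <= hat w i i * hat w j j.
Proof.
move=> w_gt0; rewrite (hat_diagE i w_gt0) (hat_diagE j w_gt0).
rewrite (hat_mul w i j w_gt0).
under eq_bigr do rewrite (hat_symE _ _ j).
by apply: sum_cauchy_schwarz => y; rewrite invr_ge0 ltW.
Qed.

(** The trace of a projection is its rank. *)
Lemma hat_trace w : (forall i, 0 < w i) -> \sum_i hat w i i / w i = k%:R.
Proof.
move=> w_gt0; transitivity (\tr (hat w *m weight_mx w)).
  by apply: eq_bigr => i _; rewrite /weight_mx mul_mx_diag !mxE.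
rewrite /hat -2!mulmxA mxtrace_mulC -!mulmxA (mulmxA A^T) -/(gram w).
by rewrite mulVmx ?gram_unit// mxtrace1.
Qed.

(** By Cauchy-Schwarz in [hat_mul], [hat w' i i ^+ 2] is at most [hat w i i] times the sum of the
    [hat w' i y ^+ 2 / w y], and that sum is at most [a * hat w' i i]. One factor cancels. *)
Lemma hat_mono w w' a i : (forall i, 0 < w i) -> (forall i, 0 < w' i) ->
  (forall i, w' i <= a * w i) -> hat w' i i <= a * hat w i i.
Proof.
move=> w_gt0 w'_gt0 w'_le.
have a_ge0 : 0 <= a by rewrite -(pmulr_lge0 _ (w_gt0 i)) (le_trans _ (w'_le i))// ltW.
have [->|h'0] := eqVneq (hat w' i i) 0; first by rewrite mulr_ge0// hat_diag_ge0.
have {h'0} h'_gt0 : 0 < hat w' i i by rewrite lt0r h'0 hat_diag_ge0.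
rewrite -(ler_pM2r h'_gt0) -expr2.
rewrite {1}(hat_mul w' i i w_gt0).
under eq_bigr do rewrite (hat_symE _ _ i).
apply: le_trans (sum_cauchy_schwarz _ _ _) _ => [y|]; first by rewrite invr_ge0 ltW.
rewrite -hat_diagE// (mulrC a) -mulrA ler_wpM2l ?hat_diag_ge0//.
rewrite (hat_diagE i w'_gt0) mulr_sumr ler_sum// => y _.
rewrite (mulrA a) ler_wpM2r ?sqr_ge0// ler_pdivlMr// mulrC ler_pdivrMr//.
Qed.

Hypothesis N_gt0 : (0 < N)%N.

(* The floor [1 / N] keeps the iterates positive at vanishing rows of [A]. *)
Definition lewis_step w i : R := Num.max (Num.sqrt (hat w i i)) N%:R^-1.

Lemma lewis_step_gt0 w i : 0 < lewis_step w i.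
Proof. by rewrite lt_max invr_gt0 ltr0n N_gt0 orbT. Qed.

(** The square root halves the logarithm of the comparison factor; the floor is harmless because
    [1 <= a]. *)
Lemma lewis_step_contract w w' a i : 1 <= a ->
  (forall i, 0 < w i) -> (forall i, 0 < w' i) ->
  (forall i, w' i <= a ^+ 2 * w i) -> lewis_step w' i <= a * lewis_step w i.
Proof.
move=> a_ge1 w_gt0 w'_gt0 w'_le.
have a_ge0 : 0 <= a by exact: le_trans a_ge1.
rewrite /lewis_step ge_max; apply/andP; split.
  apply: le_trans (_ : a * Num.sqrt (hat w i i) <= _); last first.
    by rewrite ler_wpM2l// le_max lexx.
  rewrite -[X in X * _](ger0_norm a_ge0) -sqrtr_sqr -sqrtrM ?sqr_ge0// ler_wsqrtr//.
  exact: hat_mono.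
apply: le_trans (_ : a * N%:R^-1 <= _); last by rewrite ler_wpM2l// le_max lexx orbT.
by rewrite -[leLHS]mul1r ler_wpM2r// invr_ge0 ler0n.
Qed.

(** One iteration turns the factor [2 ^+ (2 ^ j.+1)] between [w] and its image into [2 ^+ (2 ^ j)],
    so finitely many iterations reach the factor 2. *)
Lemma lewis_fixpoint_approx : exists w,
  forall i, [/\ 0 < w i, w i <= 2 * lewis_step w i & lewis_step w i <= 2 * w i].
Proof.
have iterate j : (exists2 w, (forall i, 0 < w i) &
      forall i, w i <= 2 ^+ (2 ^ j) * lewis_step w i /\
                lewis_step w i <= 2 ^+ (2 ^ j) * w i) ->
    exists w, forall i,
      [/\ 0 < w i, w i <= 2 * lewis_step w i & lewis_step w i <= 2 * w i].
  elim: j => [|j IH] [w w_gt0 w_near].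
    by exists w => i; have [] := w_near i; rewrite expr1.
  apply: IH; exists (lewis_step w); first exact: lewis_step_gt0.
  have a_ge1 : 1 <= 2 ^+ (2 ^ j) :> R by rewrite exprn_ege1// ler1n.
  rewrite expnS mulnC exprM in w_near.
  by move=> i; split; apply: lewis_step_contract => // {}i; try exact: lewis_step_gt0;
    have [] := w_near i.
(* Starting from the constant weight 1, [N] gives [1 <= B * lewis_step] through the floor, and the
   sum gives [lewis_step <= B]. *)
pose B : R := N%:R + \sum_i lewis_step (fun=> 1) i.
have B_ge0 : 0 <= B by rewrite addr_ge0// sumr_ge0// => i _; rewrite ltW// lewis_step_gt0.
apply: (iterate (Num.bound B)); exists (fun=> 1) => [//|i]; rewrite mulr1.
have B_le : B <= 2 ^+ (2 ^ Num.bound B).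
  apply: ltW; apply: upper_nthrootP; apply: ltnW; exact: ltn_expl.
split.
  apply: le_trans (_ : N%:R * N%:R^-1 <= _).
    by rewrite divff// pnatr_eq0 -lt0n.
  apply: ler_pM; rewrite ?ler0n ?invr_ge0 ?ler0n//; last by rewrite le_max lexx orbT.
  by rewrite (le_trans _ B_le)// lerDl sumr_ge0// => j _; rewrite ltW// lewis_step_gt0.
rewrite (le_trans _ B_le)// /B (bigD1 i)//= addrCA lerDl addr_ge0//.
by rewrite sumr_ge0// => j _; rewrite ltW// lewis_step_gt0.
Qed.

End Leverage.

Lemma lewis_weights (R : realType) (N k : nat) (A : 'M[R]_(N, k)) : (0 < N)%N ->
  exists (w : 'I_N -> R) (K : 'I_N -> 'I_N -> R),
  [/\ forall i, 0 < w i,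
      \sum_i w i <= (16 * k + 8)%:R,
      forall i j, `|K i j| <= 1,
      forall i, \sum_j w j * K i j ^+ 2 <= 1 &
      forall (c : 'cV[R]_k) j,
        (A *m c) j 0 = w j * \sum_i (A *m c) i 0 * K i j].
Proof.
move=> N_gt0.
(* [col_base A] spans the same column space and has full column rank, so its Gram matrix is
   invertible. *)
have B_full := col_base_full A; set B := col_base A in B_full.
have [w wP] := lewis_fixpoint_approx B_full N_gt0.
have w_gt0 i : 0 < w i by have [] := wP i.
have w_neq0 i : w i != 0 by rewrite gt_eqF.
pose H := hat B w.
have H_le i : H i i <= (2 * w i) ^+ 2.
  have [_ _] := wP i; rewrite ge_max => /andP[+ _].
  move=> H_sqrt; rewrite -(sqr_sqrtr (hat_diag_ge0 B_full i w_gt0)).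
  by apply: lerXn2r; rewrite ?nnegrE ?sqrtr_ge0// mulr_ge0// ltW.
(* The factor 4 absorbs the approximation in [H i i <= (2 * w i) ^+ 2]: with [sqr_hat_le] it gives
   [|H i j| <= 4 * w i * w j]. *)
exists (fun i => 4 * w i), (fun i j => H i j / (4 * w i * w j)); split.
- by move=> i; rewrite mulr_gt0.
- have w_le i : w i <= 4 * (H i i / w i) + 2 * N%:R^-1.
    have [_ + _] := wP i; rewrite /lewis_step -/H.
    have H_ge0 := hat_diag_ge0 B_full i w_gt0; rewrite -/H in H_ge0.
    have HV_ge0 : 0 <= H i i / w i by rewrite divr_ge0// ltW.
    have [_|_] := leP (Num.sqrt (H i i)) N%:R^-1; first by lra.
    move=> w_le; apply: le_trans (_ : 4 * (H i i / w i) <= _); last first.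
      by rewrite lerDl mulr_ge0// invr_ge0 ler0n.
    rewrite mulrA ler_pdivlMr// -expr2.
    rewrite -[X in 4 * X](sqr_sqrtr H_ge0) (_ : 4 = 2 ^+ 2); last by rewrite -natrX.
    by rewrite -exprMn; apply: lerXn2r; rewrite ?nnegrE ?mulr_ge0 ?sqrtr_ge0// ltW.
  rewrite -mulr_sumr.
  have : \sum_i w i <= \sum_i (4 * (H i i / w i) + 2 * N%:R^-1) by exact: ler_sum.
  rewrite big_split/= -mulr_sumr (hat_trace B_full)// sumr_const card_ord.
  rewrite -[_ *+ N]mulr_natr divfK ?pnatr_eq0 -?lt0n//.
  have : (\rank A)%:R <= k%:R :> R by rewrite ler_nat rank_leq_col.
  by rewrite natrD natrM; lra.
- move=> i j; rewrite -(@ler_pXn2r _ 2) ?nnegrE ?normr_ge0// expr1n.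
  rewrite real_normK ?num_real// expr_div_n ler_pdivrMr; last first.
    by rewrite exprn_gt0// !mulr_gt0.
  rewrite mul1r (le_trans (sqr_hat_le B_full i j w_gt0))//.
  apply: le_trans (ler_pM _ _ (H_le i) (H_le j)) _; rewrite ?hat_diag_ge0//.
  by rewrite le_eqVlt; apply/orP; left; apply/eqP; ring.
- move=> i; rewrite (_ : \sum_j _ = H i i / (4 * w i ^+ 2)).
    by rewrite ler_pdivrMr ?mulr_gt0 ?exprn_gt0// mul1r (le_trans (H_le i))// exprMn -natrX.
  rewrite /H (hat_diagE B_full i w_gt0) mulr_suml; apply: eq_bigr => j _.
  field; rewrite ?w_neq0 ?pnatr_eq0//.
- move=> c j; have -> : A *m c = B *m (row_base A *m c) by rewrite mulmxA mulmx_base.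
  set f := B *m _.
  have {1}-> : f = H *m weight_mx w *m f.
    by rewrite {2}/f [RHS]mulmxA (hat_reproducing B_full).
  rewrite mxE mulr_sumr; apply: eq_bigr => i _.
  have -> : (H *m weight_mx w) j i = H i j / w i.
    by rewrite /H (hat_symE _ _ i) /weight_mx mul_mx_diag !mxE.
  by field; rewrite ?w_neq0 ?pnatr_eq0.
Qed.

(** * Symmetrization and contraction *)

(** Since [expR x <= (1 - x)^-1] for [x < 1], it is enough that [(1 - y^2)^-1 <= 1 + 2 y^2], which
    holds for [y^2 <= 1/2]. *)
Lemma cosh_le (R : realType) (y : R) : `|y| <= 2^-1 ->
  expR y + expR (- y) <= 2 * (1 + 2 * y ^+ 2).
Proof.
rewrite ler_norml => /andP[y_ge y_le].
have expR_le (x : R) : x < 1 -> expR x <= (1 - x)^-1.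
  move=> x_lt1; rewrite -[x in expR x]opprK expRN lef_pV2 ?posrE ?expR_gt0 ?subr_gt0//.
  by rewrite (le_trans _ (expR_ge1Dx _)).
apply: le_trans (lerD (expR_le y _) (expR_le (- y) _)) _; try lra.
rewrite opprK.
have -> : (1 - y)^-1 + (1 + y)^-1 = 2 / (1 - y ^+ 2).
  by field; apply/and3P; split; apply/eqP; nra.
rewrite ler_pdivrMr; last by nra.
rewrite -subr_ge0 (_ : _ - 2 = 2 * y ^+ 2 * (1 - 2 * y ^+ 2)); last by ring.
by apply: mulr_ge0; [rewrite mulr_ge0 ?sqr_ge0|nra].
Qed.

Section Contraction.
Variables (R : realType) (m : nat) (V : Type) (S : V -> Prop).
Local Notation signs := {ffun 'I_m -> bool}.

Definition flip (i : 'I_m) (b : signs) : signs :=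
  [ffun j => if j == i then ~~ b j else b j].

Lemma flipK i : involutive (flip i).
Proof.
by move=> b; apply/ffunP => j; rewrite !ffunE; case: eqP => // _; exact: negbK.
Qed.

(** Sign patterns are paired by flipping sign [i], which [u] does not see. Within a pair, [phi]
    contributes at most the distance between the two values of [g]; swapping the two chosen elements
    when needed makes [g] contribute exactly that distance. *)
Lemma contraction_coord (i : 'I_m) (phi : R -> R) (u : signs -> V -> R)
    (g : V -> R) (s : signs -> V) :
  (forall x y, `|phi x - phi y| <= `|x - y|) ->
  (forall b v, u (flip i b) v = u b v) -> (forall b, S (s b)) ->
  exists2 s' : signs -> V, forall b, S (s' b) &
    \sum_b (u b (s b) + (-1) ^+ b i * phi (g (s b))) <=
    \sum_b (u b (s' b) + (-1) ^+ b i * g (s' b)).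
Proof.
move=> phi_lip u_flip sS.
pose keep (b : signs) : bool := 0 <= (-1) ^+ b i * (g (s b) - g (s (flip i b))).
exists (fun b => if keep b then s b else s (flip i b)).
  by move=> b; case: ifP.
(* Both sums are doubled and one copy is reindexed by [flip i], so that the comparison is made pair
   by pair. *)
rewrite -(ler_pM2l (ltr0Sn R 1)) !mulr_natl !mulr2n.
rewrite [X in _ + X <= _](reindex_inj (inv_inj (flipK i))).
rewrite [X in _ <= _ + X](reindex_inj (inv_inj (flipK i))).
rewrite -!big_split/=; apply: ler_sum => b _.
have flip_sign : (-1) ^+ flip i b i = - (-1) ^+ b i :> R.
  by rewrite ffunE eqxx; case: (b i); rewrite ?opprK.
have keep_flip : keep (flip i b) = keep b.
  by rewrite /keep flipK flip_sign; congr (0 <= _); ring.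
rewrite keep_flip !u_flip flip_sign flipK.
have := phi_lip (g (s b)) (g (s (flip i b))).
rewrite ler_norml => /andP[lip1 lip2].
have abs_eq x y : `|x - y| = Num.max (x - y) (y - x) :> R.
  by rewrite /Num.max; case: ltP => xy; [rewrite ltr0_norm|rewrite ger0_norm]; lra.
rewrite abs_eq in lip1 lip2; rewrite /keep.
by case: (b i) lip1 lip2; rewrite ?expr0 ?expr1; case: ifPn; rewrite -?ltNge;
   rewrite /Num.max; case: ifPn; rewrite -?leNgt; lra.
Qed.

(* The Ledoux-Talagrand contraction principle, with a choice of element for
   each sign pattern in place of a supremum over the class. *)
Lemma contraction (phi : R -> R) (g : V -> 'I_m -> R) (s : signs -> V) :
  (forall x y, `|phi x - phi y| <= `|x - y|) -> (forall b, S (s b)) ->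
  exists2 s' : signs -> V, forall b, S (s' b) &
    \sum_(b : signs) \sum_j (-1) ^+ b j * phi (g (s b) j) <=
    \sum_(b : signs) \sum_j (-1) ^+ b j * g (s' b) j.
Proof.
move=> phi_lip sS.
(* In [mixed r], [phi] has been removed from the first [r] coordinates; the induction removes it
   from one more. *)
pose mixed r (j : 'I_m) x := if (j < r)%N then x else phi x.
suff mixedP r : (r <= m)%N -> exists2 s' : signs -> V, forall b, S (s' b) &
    \sum_(b : signs) \sum_j (-1) ^+ b j * phi (g (s b) j) <=
    \sum_(b : signs) \sum_j (-1) ^+ b j * mixed r j (g (s' b) j).
  have [s' s'S s'_le] := mixedP m (leqnn m); exists s' => //.
  apply: le_trans s'_le _; apply: ler_sum => b _; apply: ler_sum => j _.
  by rewrite /mixed ltn_ord.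
elim: r => [_|r IH r_lt]; first by exists s.
have [s1 s1S s1_le] := IH (ltnW r_lt).
pose i := Ordinal r_lt.
pose u (b : signs) v := \sum_(j | j != i) (-1) ^+ b j * mixed r j (g v j).
have [|s' s'S s'_le] := @contraction_coord i phi u (fun v => g v i) s1 phi_lip _ s1S.
  move=> b v; apply: eq_bigr => j /negPf ji; by rewrite ffunE ji.
exists s' => //; apply: le_trans s1_le _.
rewrite [leLHS](_ : _ = \sum_b (u b (s1 b) + (-1) ^+ b i * phi (g (s1 b) i))); last first.
  apply: eq_bigr => b _; rewrite (bigD1 i)//= addrC; congr (_ + _ * _).
  by rewrite /mixed ltnn.
apply: le_trans s'_le _; apply: ler_sum => b _.
rewrite [leRHS](bigD1 i)//= addrC lerD ?/mixed ?ltnSn//.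
apply: ler_sum => j ji; rewrite /mixed ltnS [in leRHS]leq_eqVlt.
by rewrite (_ : (j == r :> nat) = false)//; apply: contraNF ji => /eqP jr; apply/eqP/val_inj.
Qed.

End Contraction.

Section Symmetrization.
Variables (R : realType) (m : nat) (T : finType) (q : T -> R).
Hypotheses (q_ge0 : forall x, 0 <= q x) (q_sum : \sum_x q x = 1).
Local Notation signs := {ffun 'I_m -> bool}.
Local Notation sample := {ffun 'I_m -> T}.

Definition sample_prob (I : sample) : R := \prod_j q (I j).

Lemma sample_prob_ge0 I : 0 <= sample_prob I.
Proof. by apply: prodr_ge0. Qed.

Lemma sum_sample_prod (F : 'I_m -> T -> R) :
  \sum_(I : sample) sample_prob I * \prod_j F j (I j) =
  \prod_j \sum_x q x * F j x.
Proof.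
by rewrite bigA_distr_bigA; apply: eq_bigr => I _; rewrite -big_split.
Qed.

Lemma sum_sample_prob : \sum_I sample_prob I = 1.
Proof.
rewrite -[LHS](_ : \sum_I sample_prob I * \prod_(j < m) 1 = _); last first.
  by apply: eq_bigr => I _; rewrite big1_eq mulr1.
rewrite (sum_sample_prod (fun _ _ => 1)) big1// => j _.
by under eq_bigr do rewrite mulr1.
Qed.

Lemma sum_sample_coord (j : 'I_m) (h : T -> R) :
  \sum_I sample_prob I * h (I j) = \sum_x q x * h x.
Proof.
transitivity (\sum_I sample_prob I * \prod_i (if i == j then h (I i) else 1)).
  by apply: eq_bigr => I _; rewrite -big_mkcond big_pred1_eq.
rewrite (sum_sample_prod (fun i x => if i == j then h x else 1)).
rewrite (bigD1 j)//= eqxx [X in _ * X]big1 ?mulr1// => i /negPf ->.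
by under eq_bigr do rewrite mulr1.
Qed.

Definition mix (b : signs) (p : sample * sample) : sample * sample :=
  ([ffun j => if b j then p.2 j else p.1 j],
   [ffun j => if b j then p.1 j else p.2 j]).

Lemma mixK b : involutive (mix b).
Proof.
by move=> [I I']; congr pair; apply/ffunP => j; rewrite !ffunE/=; case: (b j).
Qed.

Lemma sample_prob_mix b p :
  sample_prob (mix b p).1 * sample_prob (mix b p).2 =
  sample_prob p.1 * sample_prob p.2.
Proof.
rewrite /sample_prob -!big_split; apply: eq_bigr => j _ /=.
by rewrite !ffunE; case: (b j); rewrite // mulrC.
Qed.

(** By independence the left side is a product of [m] equal factors, the means of
    [expR y + expR (- y)]; [cosh_le] and [1 + x <= expR x] bound each. *)
Lemma rademacher_mgf (y : T -> R) : (forall x, `|y x| <= 2^-1) ->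
  \sum_I sample_prob I *
    \sum_(b : signs) expR (\sum_j (-1) ^+ b j * y (I j)) <=
  #|{: signs}|%:R * expR (m%:R * (2 * \sum_x q x * y x ^+ 2)).
Proof.
move=> y_le.
have -> : \sum_I sample_prob I *
      \sum_(b : signs) expR (\sum_j (-1) ^+ b j * y (I j)) =
    \prod_(j < m) \sum_x q x * (expR (y x) + expR (- y x)).
  rewrite -(sum_sample_prod (fun _ x => expR (y x) + expR (- y x))).
  apply: eq_bigr => I _; congr (_ * _).
  transitivity (\sum_(b : signs) \prod_j expR ((-1) ^+ b j * y (I j))).
    by apply: eq_bigr => b _; exact: expR_sum.
  rewrite -(bigA_distr_bigA (fun j c => expR ((-1) ^+ nat_of_bool c * y (I j)))).
  apply: eq_bigr => j _; rewrite big_bool/= expr1 expr0 mul1r mulN1r addrC//.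
rewrite prodr_const !card_ord card_ffun card_bool card_ord natrX expRM_natl -exprMn.
apply: lerXn2r; rewrite ?nnegrE ?mulr_ge0 ?expR_ge0//.
  by apply: sumr_ge0 => x _; rewrite mulr_ge0// addr_ge0// expR_ge0.
apply: le_trans (_ : 2 * (1 + 2 * \sum_x q x * y x ^+ 2) <= _); last first.
  by rewrite ler_wpM2l// expR_ge1Dx.
have -> : 2 * (1 + 2 * \sum_x q x * y x ^+ 2) =
    \sum_x q x * (2 * (1 + 2 * y x ^+ 2)).
  transitivity (\sum_x (2 * q x + 4 * (q x * y x ^+ 2))).
    by rewrite big_split/= -!mulr_sumr q_sum; ring.
  by apply: eq_bigr => x _; ring.
by apply: ler_sum => x _; rewrite ler_wpM2l// cosh_le.
Qed.

Variables (V : Type) (S : V -> Prop) (g : V -> T -> R).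
(** [Psi I b] stands in for the supremum over [S] of the signed sum. *)
Variable Psi : sample -> signs -> R.
Hypothesis g_le : forall v (I : sample) (b : signs), S v ->
  \sum_j (-1) ^+ b j * g v (I j) <= Psi I b.

(** The map [F] picks an element of [S] for each sample, in place of a supremum of the deviation.
    The factor 2 counts the sample and its independent copy. *)
Lemma symmetrization (phi : R -> R) (F : sample -> V) :
  (forall x y, `|phi x - phi y| <= `|x - y|) -> (forall I, S (F I)) ->
  #|{: signs}|%:R * (\sum_I sample_prob I *
    (\sum_j phi (g (F I) (I j)) - m%:R * \sum_x q x * phi (g (F I) x))) <=
  2 * \sum_I sample_prob I * \sum_b Psi I b.
Proof.
move=> phi_lip FS.
(* Exchanging the coordinates selected by [b] between the sample and an
   independent copy of it preserves the product weight. *)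
have ghost (b : signs) : \sum_I sample_prob I *
      (\sum_j phi (g (F I) (I j)) - m%:R * \sum_x q x * phi (g (F I) x)) =
    \sum_p sample_prob p.1 * sample_prob p.2 * \sum_j (-1) ^+ b j *
      (phi (g (F (mix b p).1) (p.1 j)) - phi (g (F (mix b p).1) (p.2 j))).
  rewrite [RHS](reindex_inj (inv_inj (mixK b))).
  transitivity (\sum_(I : sample) \sum_(I' : sample) sample_prob I * sample_prob I' *
      \sum_j (phi (g (F I) (I j)) - phi (g (F I) (I' j)))).
    apply: eq_bigr => I _; under [RHS]eq_bigr do rewrite -mulrA.
    rewrite -mulr_sumr; congr (_ * _).
    under [RHS]eq_bigr do rewrite sumrB mulrBr.
    rewrite sumrB -mulr_suml sum_sample_prob mul1r; congr (_ - _).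
    under [RHS]eq_bigr do rewrite mulr_sumr.
    rewrite exchange_big/=.
    under [RHS]eq_bigr do rewrite (sum_sample_coord _ (fun x => phi (g (F I) x))).
    by rewrite sumr_const card_ord mulr_natl.
  rewrite pair_bigA; apply: eq_bigr => p _.
  rewrite mixK sample_prob_mix; congr (_ * _); apply: eq_bigr => j _.
  by rewrite !ffunE; case: (b j); rewrite ?expr0 ?expr1 ?mul1r// mulN1r opprB.
(* For a fixed pair [p] the chosen element depends on [b] alone, so [contraction] applies to each
   half separately, with [- phi] in the second. *)
have fixed (p : sample * sample) : \sum_(b : signs) \sum_j (-1) ^+ b j *
      (phi (g (F (mix b p).1) (p.1 j)) - phi (g (F (mix b p).1) (p.2 j))) <=
    \sum_b Psi p.1 b + \sum_b Psi p.2 b.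
  under eq_bigr do (under eq_bigr do rewrite mulrBr; rewrite sumrB -sumrN).
  rewrite big_split; apply: lerD.
    have [s sS /le_trans] := contraction (fun v j => g v (p.1 j)) phi_lip
      (fun b => FS (mix b p).1).
    by apply; apply: ler_sum => b _; exact: g_le.
  have phiN_lip x y : `|- phi x - - phi y| <= `|x - y|.
    by rewrite -opprD normrN.
  have [s sS /le_trans] := contraction (fun v j => g v (p.2 j)) phiN_lip
      (fun b => FS (mix b p).1).
  under eq_bigr do under eq_bigr do rewrite -mulrN.
  by apply; apply: ler_sum => b _; exact: g_le.
(* The same number [X] is written once per sign pattern [b], each time through the exchange given by
   that [b]. *)
set X := \sum_I _; have -> : #|{: signs}|%:R * X = \sum_(b : signs) X.
  by rewrite sumr_const mulr_natl.
rewrite (eq_bigr _ (fun b _ => ghost b)) exchange_big/=.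
under eq_bigr do rewrite -mulr_sumr.
apply: le_trans (_ : \sum_p sample_prob p.1 * sample_prob p.2 *
    (\sum_b Psi p.1 b + \sum_b Psi p.2 b) <= _).
  apply: ler_sum => p _; apply: ler_wpM2l; last exact: fixed.
  by rewrite mulr_ge0 ?sample_prob_ge0.
rewrite -(pair_bigA _ (fun I I' => sample_prob I * sample_prob I' *
    (\sum_b Psi I b + \sum_b Psi I' b)))/=.
under eq_bigr do (under eq_bigr do rewrite mulrDr; rewrite big_split/=).
rewrite big_split/= mulr_natl mulr2n lerD//.
  under eq_bigr do under eq_bigr do rewrite mulrAC.
  by under eq_bigr do rewrite -mulr_sumr sum_sample_prob mulr1.
rewrite exchange_big/=; under eq_bigr do under eq_bigr do rewrite -mulrA mulrC.
by under eq_bigr do rewrite -mulr_sumr sum_sample_prob mulr1.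
Qed.

(** If every sample failed, choosing a violating element for each would make the mean absolute
    deviation at least [e]. Symmetrization bounds its positive and negative parts, which gives the
    factor 4. *)
Lemma exists_good_sample (e : R) (v0 : V) : S v0 -> (forall x, g v0 x = 0) ->
  4 * (\sum_I sample_prob I * \sum_b Psi I b) < #|{: signs}|%:R * e ->
  exists I : sample, forall v, S v ->
    `|\sum_j `|g v (I j)| - m%:R * \sum_x q x * `|g v x| | <= e.
Proof.
move=> v0S g0 Psi_lt; apply: contrapT => none.
pose D (I : sample) v : R := \sum_j `|g v (I j)| - m%:R * \sum_x q x * `|g v x|.
have {none} bad (I : sample) : exists v, S v /\ e < `|D I v|.
  apply: contrapT => noneI; apply: none; exists I => v vS.
  by rewrite leNgt; apply/negP => lt_e; apply: noneI; exists v.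
have [F FP] := choice bad.
(* The violators are split by the sign of their deviation; [v0], whose deviation is zero, fills the
   gaps. *)
pose Fp I := if 0 <= D I (F I) then F I else v0.
pose Fm I := if 0 <= D I (F I) then v0 else F I.
have D0 I : D I v0 = 0.
  rewrite /D big1 ?big1 ?mulr0 ?subr0// => [x|j] _; rewrite g0 normr0 ?mulr0//.
have normD I : `|D I (F I)| = D I (Fp I) + - D I (Fm I).
  rewrite /Fp /Fm; case: ifPn => [/ger0_norm ->|]; rewrite D0 ?subr0//.
  by rewrite -ltNge => /ltr0_norm ->; rewrite add0r.
have FpS I : S (Fp I) by rewrite /Fp; case: ifP => // _; have [] := FP I.
have FmS I : S (Fm I) by rewrite /Fm; case: ifP => // _; have [] := FP I.
have lip1 (x y : R) : `| `|x| - `|y| | <= `|x - y| by exact: ler_dist_dist.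
have lip2 (x y : R) : `| - `|x| - - `|y| | <= `|x - y|.
  by rewrite -opprD normrN ler_dist_dist.
have sym1 := symmetrization lip1 FpS; have sym2 := symmetrization lip2 FmS.
have : #|{: signs}|%:R * e <= #|{: signs}|%:R * \sum_I sample_prob I * `|D I (F I)|.
  rewrite ler_wpM2l ?ler0n// -[leLHS]mul1r -sum_sample_prob mulr_suml.
  by apply: ler_sum => I _; rewrite ler_wpM2l ?sample_prob_ge0// ltW//; have [] := FP I.
rewrite (eq_bigr (fun I => sample_prob I * D I (Fp I) + sample_prob I * - D I (Fm I))); last first.
  by move=> I _; rewrite normD mulrDr.
rewrite big_split/= mulrDr => e_le.
have {}sym2 : #|{: signs}|%:R * (\sum_I sample_prob I * - D I (Fm I)) <=
    2 * \sum_I sample_prob I * \sum_b Psi I b.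
  apply: le_trans sym2; rewrite le_eqVlt; apply/orP; left; apply/eqP; congr (_ * _).
  apply: eq_bigr => I _; congr (_ * _); rewrite /D opprB sumrN addrC; congr (_ + _).
  by rewrite -mulrN -sumrN; congr (_ * _); apply: eq_bigr => x _; rewrite mulrN opprK.
have {}sym1 : #|{: signs}|%:R * (\sum_I sample_prob I * D I (Fp I)) <=
    2 * \sum_I sample_prob I * \sum_b Psi I b by exact: sym1.
lra.
Qed.

End Symmetrization.

(** * Random sampling of rows *)

Lemma row_sampling (R : realType) (N m : nat) (w : 'I_N -> R)
    (K : 'I_N -> 'I_N -> R) (W e : R) :
  (0 < N)%N -> (forall i, 0 < w i) -> \sum_i w i <= W -> 1 <= W ->
  (forall i j, `|K i j| <= 1) -> (forall i, \sum_j w j * K i j ^+ 2 <= 1) ->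
  0 < e <= 1 -> 128 * W * (ln W + 2) < e ^+ 2 * m%:R ->
  exists (I : 'I_m -> 'I_N) (s : 'I_N -> R), (forall i, 0 <= s i) /\
    forall f : 'I_N -> R, (forall j, f j = w j * \sum_i f i * K i j) ->
      `|\sum_j s (I j) * `|f (I j)| - \sum_i `|f i| | <= e * \sum_i `|f i|.
Proof.
move=> N_gt0 w_gt0 w_le W_ge1 K_le K_sqr /andP[e_gt0 e_le1] m_large.
have W_gt0 : 0 < W by exact: lt_le_trans W_ge1.
have lnW_ge0 : 0 <= ln W by exact: ln_ge0.
have m_gt0 : 0 < m%:R :> R.
  rewrite -(pmulr_rgt0 _ (exprn_gt0 2 e_gt0)); apply: le_lt_trans m_large.
  by rewrite !mulr_ge0 ?ltW// ltr_wpDl.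
set w0 := \sum_i w i in w_le *.
have w0_gt0 : 0 < w0.
  rewrite /w0 (bigD1 (Ordinal N_gt0))//= ltr_wpDr// sumr_ge0// => i _; exact: ltW.
have wW_le1 : w0 / W <= 1 by rewrite ler_pdivrMr// mul1r.
have wW_ge0 : 0 <= w0 / W by rewrite divr_ge0 ?ltW.
pose q i := w i / w0.
have q_ge0 i : 0 <= q i by rewrite divr_ge0 ?ltW.
have q_sum : \sum_i q i = 1 by rewrite -mulr_suml divff// gt_eqF.
(* This is [f i / (m q i)], so [m] times the mean of [|g f|] under [q] is the [l_1] norm of [f]. *)
pose g (f : 'I_N -> R) i := w0 / m%:R * (f i / w i).
pose S (f : 'I_N -> R) :=
  (forall j, f j = w j * \sum_i f i * K i j) /\ \sum_i `|f i| <= 1.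
(* [a] bounds the exponent that [rademacher_mgf] produces at scale [lam], and [expR (- L)] cancels
   both [expR a] and the total mass [W]. The lower bound on [m] then gives
   [4 * (L + 2) / lam < e]. *)
pose lam := e * m%:R / (16 * W).
pose a := e ^+ 2 * m%:R / (128 * W).
pose L := ln W + a.
pose t (I : {ffun 'I_m -> 'I_N}) (b : {ffun 'I_m -> bool}) i :=
  w0 / m%:R * \sum_j (-1) ^+ b j * K i (I j).
pose Psi I b := lam^-1 * (L + expR (- L) *
  \sum_i w i * (expR (lam * t I b i) + expR (- (lam * t I b i)))).
have lam_gt0 : 0 < lam by rewrite divr_gt0 ?mulr_gt0.
have a_gt0 : 0 < a by rewrite divr_gt0 ?mulr_gt0 ?exprn_gt0.
have L_ge0 : 0 <= L by rewrite addr_ge0// ltW.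
have g_le f (I : {ffun 'I_m -> 'I_N}) (b : {ffun 'I_m -> bool}) : S f ->
    \sum_j (-1) ^+ b j * g f (I j) <= Psi I b.
  move=> [fK f_le1].
  (* The reproducing identity for [f] moves the signs onto the kernel. *)
  have -> : \sum_j (-1) ^+ b j * g f (I j) = \sum_i f i * t I b i.
    rewrite /t; under [RHS]eq_bigr do rewrite mulrCA !mulr_sumr.
    rewrite exchange_big/=; apply: eq_bigr => j _.
    rewrite /g {1}fK (mulrC (w _)) mulfK ?gt_eqF// !mulr_sumr.
    by apply: eq_bigr => i _; ring.
  rewrite /Psi -ler_pdivrMl ?invr_gt0// invrK [leLHS]mulr_sumr.
  have f_le i : `|f i| <= w i.
    rewrite {1}fK normrM gtr0_norm// -[leRHS]mulr1 ler_wpM2l ?(ltW (w_gt0 i))//.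
    apply: le_trans (ler_norm_sum _ _ _) _; apply: le_trans f_le1.
    by apply: ler_sum => l _; rewrite normrM -[leRHS]mulr1 ler_wpM2l.
  apply: le_trans (_ : \sum_i (L * `|f i| + expR (- L) * (w i *
      (expR (lam * t I b i) + expR (- (lam * t I b i))))) <= _); last first.
    rewrite big_split/= -!mulr_sumr lerD2r -[leRHS]mulr1.
    by rewrite ler_wpM2l.
  apply: ler_sum => i _.
  set E := _ + expR _.
  (* Uses [1 + x <= expR x] at [x = lam * |t| - L], then [expR |y| <= expR y + expR (- y)]. *)
  have lt_le : lam * `|t I b i| <= L + expR (- L) * E.
    apply: le_trans (_ : L + expR (lam * `|t I b i| - L) <= _).
      by have := expR_ge1Dx (lam * `|t I b i| - L); lra.
    rewrite lerD2l expRD mulrC ler_wpM2l ?expR_ge0// /E.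
    have := expR_ge0 (lam * t I b i); have := expR_ge0 (- (lam * t I b i)).
    by case: (ger0P (t I b i)) => _; rewrite ?mulrN; lra.
  apply: le_trans (_ : `|f i| * (lam * `|t I b i|) <= _).
    by rewrite [leRHS]mulrCA -normrM ler_wpM2l ?(ltW lam_gt0)// ler_norm.
  apply: le_trans (ler_wpM2l (normr_ge0 _) lt_le) _.
  rewrite mulrDr (mulrC L) lerD2l mulrCA ler_wpM2l ?expR_ge0// ler_wpM2r//.
  by rewrite addr_ge0// expR_ge0.
set M : R := #|{: {ffun 'I_m -> bool}}|%:R.
have M_gt0 : 0 < M by rewrite /M card_ffun card_bool ltr0n expn_gt0.
have mgf (z : R) i : `|z| = lam ->
    \sum_I sample_prob q I * \sum_b expR (z * t I b i) <= M * expR a.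
  move=> z_lam; pose y x := z * (w0 / m%:R) * K i x.
  have lam_w0 : lam * (w0 / m%:R) <= 16^-1.
    rewrite /lam (_ : _ * _ = e * (w0 / W) / 16); last by field; rewrite ?gt_eqF.
    rewrite -[leRHS]mul1r ler_wpM2r ?invr_ge0//.
    by rewrite mulr_ile1// ltW.
  have y_le x : `|y x| <= 2^-1.
    have wm_ge0 : 0 <= w0 / m%:R by rewrite divr_ge0 ?ltW.
    rewrite /y normrM (normrM z) z_lam (ger0_norm wm_ge0).
    apply: le_trans (_ : 16^-1 * 1 <= _); last by lra.
    by apply: ler_pM; rewrite // mulr_ge0// ltW.
  have := rademacher_mgf m q_ge0 q_sum y_le; rewrite -/M.
  rewrite (eq_bigr (fun I => sample_prob q I * \sum_b expR (z * t I b i))); last first.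
    move=> I _; congr (_ * _); apply: eq_bigr => b _; congr expR.
    by rewrite /t mulrA mulr_sumr; apply: eq_bigr => j _; rewrite /y mulrCA.
  move=> /le_trans; apply; rewrite ler_wpM2l ?(ltW M_gt0)// ler_expR.
  have -> : \sum_x q x * y x ^+ 2 = (lam * (w0 / m%:R)) ^+ 2 / w0 * \sum_x w x * K i x ^+ 2.
    rewrite mulr_sumr; apply: eq_bigr => x _.
    rewrite /q /y -z_lam !exprMn real_normK ?num_real//; ring.
  rewrite mulrA mulrA.
  set c := _ / w0.
  have c_ge0 : 0 <= c by rewrite divr_ge0 ?sqr_ge0// ltW.
  have {}c_ge0 : 0 <= m%:R * 2 * c by rewrite mulr_ge0// mulr_ge0// ltW.
  apply: le_trans (ler_wpM2l c_ge0 (K_sqr i)) _; rewrite mulr1 /c /a.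
  have -> : m%:R * 2 * ((lam * (w0 / m%:R)) ^+ 2 / w0) =
      (w0 / W) * (e ^+ 2 * m%:R / (128 * W)).
    by rewrite /lam; field; rewrite ?gt_eqF.
  rewrite -[leRHS]mul1r ler_wpM2r ?(ltW a_gt0)//.
(* A mean over samples but a plain sum over signs, so constants are multiplied by [M]. *)
pose E (X : {ffun 'I_m -> 'I_N} -> {ffun 'I_m -> bool} -> R) : R :=
  \sum_I sample_prob q I * \sum_b X I b.
have ED X Y : E (fun I b => X I b + Y I b) = E X + E Y.
  by rewrite -big_split; apply: eq_bigr => I _; rewrite big_split mulrDr.
have EZ c X : E (fun I b => c * X I b) = c * E X.
  by rewrite /E mulr_sumr; apply: eq_bigr => I _; rewrite -mulr_sumr mulrCA.
have Esum (X : 'I_N -> {ffun 'I_m -> 'I_N} -> {ffun 'I_m -> bool} -> R) :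
    E (fun I b => \sum_i X i I b) = \sum_i E (X i).
  by rewrite exchange_big; apply: eq_bigr => I _; rewrite exchange_big mulr_sumr.
have Econst c : E (fun _ _ => c) = M * c.
  by rewrite /E -mulr_suml sum_sample_prob// mul1r sumr_const -mulr_natl.
have Psi_lt : 4 * E Psi < M * e.
  rewrite /Psi EZ ED EZ Econst Esum.
  apply: le_lt_trans (_ : 4 * (lam^-1 * (M * (L + 2))) < _).
    do 2!(apply: ler_wpM2l; first by rewrite ?invr_ge0 ?ltW).
    rewrite (mulrDr M L) lerD2l.
    apply: le_trans (_ : expR (- L) * (w0 * (M * expR a + M * expR a)) <= _).
      rewrite ler_wpM2l ?expR_ge0// mulr_suml ler_sum// => i _.
      rewrite EZ ler_wpM2l ?(ltW (w_gt0 i))// ED lerD//; first by apply: mgf; rewrite gtr0_norm.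
      rewrite (_ : E _ = \sum_I sample_prob q I * \sum_b expR (- lam * t I b i)).
        by apply: mgf; rewrite normrN gtr0_norm.
      by apply: eq_bigr => I _; congr (_ * _); apply: eq_bigr => b _; rewrite mulNr.
    rewrite /L opprD expRD (expRN (ln W)) lnK ?posrE// expRN.
    rewrite (_ : _ * _ = M * 2 * (w0 / W)); last first.
      by field; rewrite ?gt_eqF ?expR_gt0.
    rewrite -[leRHS]mulr1 ler_wpM2l ?mulr_ge0 ?(ltW M_gt0)//.
  rewrite [ltLHS](_ : _ = M * (4 * (L + 2) / lam)); last by ring.
  rewrite ltr_pM2l// ltr_pdivrMr//.
  set X := e ^+ 2 * m%:R / W.
  have -> : e * lam = X / 16 by rewrite /lam /X; field; rewrite gt_eqF.
  have aX : a = X / 128 by rewrite /a /X; field; rewrite gt_eqF.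
  have : ln W + 2 < X / 128.
    by rewrite -aX /a ltr_pdivlMr ?mulr_gt0// mulrC.
  by rewrite /L aX; lra.
have g0 x : g (fun=> 0) x = 0 by rewrite /g mul0r mulr0.
have S0 : S (fun=> 0).
  split=> [j|]; first by rewrite big1 ?mulr0// => i _; rewrite mul0r.
  by rewrite big1// => i _; rewrite normr0.
have [I IP] := exists_good_sample q_ge0 q_sum g_le S0 g0 Psi_lt.
pose s i := w0 / m%:R / w i.
have s_ge0 i : 0 <= s i by rewrite !divr_ge0 ?ltW.
exists I, s; split=> // f fK.
set n : R := \sum_i `|f i|.
have n_ge0 : 0 <= n by apply: sumr_ge0.
(* The claim is homogeneous: for [n != 0] the function [f / n] lies in [S]. *)
have [n0|n_neq0] := eqVneq n 0.
  have f0 i : `|f i| = 0 by have := psumr_eq0P (fun j _ => normr_ge0 (f j)) n0 (i := i) isT.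
  by rewrite n0 mulr0 big1 ?subrr ?normr0// => j _; rewrite f0 mulr0.
have n_gt0 : 0 < n by rewrite lt0r n_neq0.
have norm_f' i : `|f i / n| = `|f i| / n by rewrite normrM normfV (ger0_norm n_ge0).
have f'_sum : \sum_i `|f i / n| = 1.
  by under eq_bigr do rewrite norm_f'; rewrite -mulr_suml divff.
have : S (fun i => f i / n).
  split=> [j|]; last by rewrite f'_sum.
  rewrite fK -mulrA mulr_suml; congr (_ * _); apply: eq_bigr => i _; ring.
move=> /IP.
have norm_g i : `|g (fun i => f i / n) i| = s i * `|f i| / n.
  have -> : g (fun i => f i / n) i = s i * (f i / n) by rewrite /g /s; ring.
  by rewrite normrM norm_f' (ger0_norm (s_ge0 i)) mulrA.
have -> : \sum_j `|g (fun i => f i / n) (I j)| = (\sum_j s (I j) * `|f (I j)|) / n.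
  by rewrite mulr_suml; apply: eq_bigr => j _; rewrite norm_g.
have -> : m%:R * \sum_x q x * `|g (fun i => f i / n) x| = n / n.
  rewrite mulr_sumr {1}/n mulr_suml; apply: eq_bigr => x _; rewrite norm_g /q /s.
  by field; rewrite n_neq0 ?gt_eqF.
rewrite -mulrBl normrM normfV (ger0_norm n_ge0) ler_pdivrMr//.
Qed.

(** The constant 24 comes from [16 k + 8 <= 24 n]. *)
Lemma matrix_subsample (R : realType) (N k n m : nat) (A : 'M[R]_(N, k)) (e : R) :
  (0 < N)%N -> (k <= n)%N -> (0 < n)%N -> 0 < e <= 1 ->
  128 * (24 * n%:R) * (ln (24 * n%:R) + 2) < e ^+ 2 * m%:R ->
  exists (I : 'I_m -> 'I_N) (s : 'I_N -> R), (forall i, 0 <= s i) /\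
    forall c : 'cV[R]_k,
      `|\sum_j s (I j) * `|(A *m c) (I j) 0| - \sum_i `|(A *m c) i 0| | <=
      e * \sum_i `|(A *m c) i 0|.
Proof.
move=> N_gt0 k_le n_gt0 e01 m_large.
have [w [K [w_gt0 w_le K_le K_sqr K_repr]]] := lewis_weights A N_gt0.
have {}w_le : \sum_i w i <= 24 * n%:R.
  by rewrite (le_trans w_le)// -natrM ler_nat; lia.
have W_ge1 : 1 <= 24 * n%:R :> R by rewrite -natrM ler1n; lia.
have [I [s [s_ge0 sP]]] :=
  row_sampling N_gt0 w_gt0 w_le W_ge1 K_le K_sqr e01 m_large.
by exists I, s; split=> // c; apply: sP => j; exact: K_repr.
Qed.

(** * Discretization of a measure *)

Section BoundedMeasurable.
Context {d : measure_display} {T : measurableType d} {R : realType}.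
Variable mu : probability T R.
Implicit Types f g : T -> R.

(** A class stable under the operations used below and integrable for every probability, which
    settles all integrability conditions. *)
Definition bounded_measurable f :=
  measurable_fun setT f /\ exists B, forall x, `|f x| <= B.

Lemma bounded_measurable_cst (a : R) : bounded_measurable (fun=> a).
Proof. by split; [exact: measurable_cst|exists `|a|]. Qed.

Lemma bounded_measurableD f g :
  bounded_measurable f -> bounded_measurable g ->
  bounded_measurable (fun x => f x + g x).
Proof.
move=> [mf [B f_le]] [mg [C g_le]]; split; first exact: measurable_funD.
by exists (B + C) => x; rewrite (le_trans (ler_normD _ _))// lerD.
Qed.

Lemma bounded_measurableM f g :
  bounded_measurable f -> bounded_measurable g ->
  bounded_measurable (fun x => f x * g x).
Proof.
move=> [mf [B f_le]] [mg [C g_le]]; split; first exact: measurable_funM.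
by exists (B * C) => x; rewrite normrM ler_pM.
Qed.

Lemma bounded_measurable_norm f :
  bounded_measurable f -> bounded_measurable (fun x => `|f x|).
Proof.
move=> [mf [B f_le]]; split; first exact: measurableT_comp.
by exists B => x; rewrite normr_id.
Qed.

Lemma bounded_measurable_indic (A : set T) :
  measurable A -> bounded_measurable (\1_A : T -> R).
Proof.
move=> mA; split; first exact: measurable_indic.
by exists 1 => x; rewrite indicE; case: (_ \in _); rewrite ?normr1// normr0.
Qed.

Lemma bounded_measurable_sum (I : Type) (s : seq I) (c : I -> R)
    (f : I -> T -> R) : (forall i, bounded_measurable (f i)) ->
  bounded_measurable (fun x => \sum_(i <- s) c i * f i x).
Proof.
move=> bmf; elim: s => [|i s IH].
  by under eq_fun do rewrite big_nil; exact: bounded_measurable_cst.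
under eq_fun do rewrite big_cons; apply: bounded_measurableD => //.
exact: bounded_measurableM (bounded_measurable_cst _) (bmf i).
Qed.

Lemma bounded_measurable_integrable f :
  bounded_measurable f -> mu.-integrable setT (EFin \o f).
Proof.
move=> [mf [B f_le]]; apply: measurable_bounded_integrable => //.
  exact: le_lt_trans (probability_le1 mu measurableT) (ltry _).
exists B; split; first exact: num_real.
by move=> M BM x _; rewrite /= (le_trans (f_le x))// ltW.
Qed.

Lemma integral_bounded_measurable f : bounded_measurable f ->
  (\int[mu]_x (f x)%:E)%E = (\int[mu]_x f x)%:E.
Proof.
move=> /bounded_measurable_integrable fi.
by rewrite /Rintegral fineK// integrable_fin_num.
Qed.

Lemma Rintegral_sum (I : Type) (s : seq I) (c : I -> R) (f : I -> T -> R) :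
  (forall i, bounded_measurable (f i)) ->
  \int[mu]_x (\sum_(i <- s) c i * f i x) = \sum_(i <- s) c i * \int[mu]_x f i x.
Proof.
move=> bmf; elim: s => [|i s IH].
  under eq_Rintegral do rewrite big_nil.
  by rewrite Rintegral_cst// mul0r big_nil.
under eq_Rintegral do rewrite big_cons.
rewrite RintegralD//.
- by rewrite IH big_cons RintegralZl//; exact: bounded_measurable_integrable.
- apply: bounded_measurable_integrable.
  exact: bounded_measurableM (bounded_measurable_cst _) (bmf i).
- by apply: bounded_measurable_integrable; exact: bounded_measurable_sum.
Qed.

Lemma Rintegral_norm_le_ae f (e : R) : bounded_measurable f -> 0 <= e ->
  {ae mu, forall x, `|f x| <= e} -> `|\int[mu]_x f x| <= e.
Proof.
move=> bmf e_ge0 f_le.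
have bmn := bounded_measurable_norm bmf.
apply: le_trans (le_normr_Rintegral _ (bounded_measurable_integrable bmf)) _ => //.
rewrite -lee_fin -integral_bounded_measurable//.
rewrite -[leRHS]mule1 -(probability_setT mu) -[leRHS]integral_cst//.
apply: ae_ge0_le_integral => //.
- by apply/measurable_EFinP; case: bmn.
- by apply: filterS f_le => x f_le _; rewrite lee_fin.
Qed.

Lemma Rintegral_sqr_eq0 f : bounded_measurable f ->
  \int[mu]_x (f x * f x) = 0 -> {ae mu, forall x, f x = 0}.
Proof.
move=> bmf f0.
have bmff := bounded_measurableM bmf bmf.
have : (\int[mu]_x `|(f x * f x)%:E|)%E = 0%E.
  under eq_integral do rewrite abse_EFin (ger0_norm (sqr_ge0 (f _))).
  by rewrite integral_bounded_measurable// f0.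
have mff : measurable_fun setT (EFin \o (fun x => f x * f x)).
  by apply/measurable_EFinP; case: bmff.
move/(ae_eq_integral_abs mu measurableT mff); apply: filterS => x /(_ I) [].
by move/eqP; rewrite mulf_eq0 orbb => /eqP.
Qed.

(** A cell is a vector of values of the shifted [b i] rounded down to multiples of [delta];
    boundedness leaves finitely many. *)
Lemma small_oscillation_partition (k : nat) (b : 'I_k -> T -> R) (delta : R) :
  0 < delta -> (forall i, bounded_measurable (b i)) ->
  exists (P : finType) (phi : T -> P),
    (forall t, measurable (phi @^-1` [set t])) /\
    forall x y, phi x = phi y -> forall i, `|b i x - b i y| <= delta.
Proof.
move=> delta_gt0 bmb.
have [B0 B0_le] := choice (fun i => (bmb i).2).
pose B := \sum_i `|B0 i|.
have b_le i x : `|b i x| <= B.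
  rewrite (le_trans (B0_le i x))// (le_trans (ler_norm _))//.
  by rewrite /B (bigD1 i)//= lerDl sumr_ge0.
pose r i x := (b i x + B) / delta.
have r_ge0 i x : 0 <= r i x.
  rewrite divr_ge0 ?(ltW delta_gt0)//.
  by have := b_le i x; rewrite ler_norml => /andP[]; lra.
(* [M] bounds the rounded values, so [inord] never returns its default. *)
pose M := Num.truncn (2 * B / delta).
have r_le i x : (Num.truncn (r i x) < M.+1)%N.
  rewrite ltnS; apply: le_truncn; rewrite ler_pM2r ?invr_gt0//.
  by have := b_le i x; rewrite ler_norml => /andP[]; lra.
pose phi x := [ffun i => inord (Num.truncn (r i x)) : 'I_M.+1].
exists _, phi; split=> [t|x y phixy i].
  rewrite (_ : phi @^-1` _ = \bigcap_(i in [set: 'I_k])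
      (setT `&` b i @^-1` `[(t i)%:R * delta - B, (t i).+1%:R * delta - B[%classic)).
    apply: fin_bigcap_measurable => // i _.
    by apply: (bmb i).1 => //; exact: measurable_itv.
  apply/seteqP; split=> [x /= <- i _|x xt].
    split=> //=; rewrite in_itv/= ffunE inordK//.
    have := truncn_itv (r_ge0 i x).
    by rewrite ler_pdivlMr// ltr_pdivrMr// lerBlDr ltrBrDr.
  apply/ffunP => i; rewrite ffunE; apply/val_inj; rewrite /= inordK//; apply/eqP.
  rewrite truncn_eq// ler_pdivlMr// ltr_pdivrMr//.
  by have [_] := xt i I; rewrite /= in_itv/= lerBlDr ltrBrDr.
have rxy : Num.truncn (r i x) = Num.truncn (r i y).
  move: phixy => /(congr1 (fun f : {ffun _ -> _} => val (f i))).
  by rewrite !ffunE /= !inordK.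
have := truncn_itv (r_ge0 i x); have := truncn_itv (r_ge0 i y); rewrite rxy.
rewrite ler_pdivlMr// ltr_pdivrMr// ler_pdivlMr// ltr_pdivrMr// -natr1.
move=> /andP[y1 y2] /andP[x1 x2]; rewrite ler_norml; apply/andP; lra.
Qed.

(** The new measure puts the mass of each cell at one of its points. The error is relative even when
    the [b i] are dependent modulo null sets. *)
Lemma discretize_measure (k : nat) (b : 'I_k -> T -> R) (e : R) :
  0 < e -> (forall i, bounded_measurable (b i)) ->
  exists (P : finType) (pt : P -> T) (p : P -> R),
    [/\ (0 < #|P|)%N, forall t, 0 <= p t & forall c : 'I_k -> R,
      `|\sum_t p t * `|\sum_i c i * b i (pt t)| -
        \int[mu]_x `|\sum_i c i * b i x| | <=
      e * \int[mu]_x `|\sum_i c i * b i x|].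
Proof.
move=> e_gt0 bmb.
pose bcol x : 'cV[R]_k := \col_i b i x.
pose f (v : 'rV[R]_k) x : R := (v *m bcol x) 0 0.
have fE v x : f v x = \sum_i v 0 i * b i x.
  by rewrite /f mxE; apply: eq_bigr => i _; rewrite mxE.
have bmf v : bounded_measurable (f v).
  by rewrite (funext (fE v)); exact: bounded_measurable_sum.
pose G : 'M[R]_k := \matrix_(i, j) \int[mu]_x (b i x * b j x).
have vGE v j : (v *m G) 0 j = \int[mu]_x (f v x * b j x).
  rewrite mxE; under [RHS]eq_Rintegral do rewrite fE mulr_suml.
  under [RHS]eq_Rintegral do under eq_bigr do rewrite -mulrA.
  rewrite (Rintegral_sum _ _ (f := fun i x => b i x * b j x)).
    by apply: eq_bigr => i _; rewrite mxE.
  by move=> i; exact: bounded_measurableM.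
(* [f v] is null for [v] in the row space of [D], so [proj v] represents the same
   class as [v], with coefficients bounded by [J v] through [vG_le]. *)
pose D : 'M[R]_k := 1%:M - G *m pinvmx G.
have DG : D *m G = 0 by rewrite mulmxBl mul1mx mulmxKpV ?submx_refl// subrr.
(* Rows of [D] annihilate [G], so the corresponding [f] have square integral zero and vanish almost
   everywhere. *)
pose Z x := forall i, f (row i D) x = 0.
have aeZ : {ae mu, forall x, Z x}.
  apply: filter_forall => i; apply: Rintegral_sqr_eq0 (bmf _) _.
  under eq_Rintegral => x _.
    rewrite {2}fE mulr_sumr; under eq_bigr do rewrite mulrCA; over.
  rewrite (Rintegral_sum _ _ (f := fun j x => f (row i D) x * b j x)).
    by rewrite big1// => j _; rewrite -vGE -row_mul DG row0 [X in _ * X]mxE mulr0.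
  by move=> j; exact: bounded_measurableM.
pose proj (v : 'rV[R]_k) := v *m (G *m pinvmx G).
have fZ v x : Z x -> f v x = f (proj v) x.
  move=> Zx; have Dx : D *m bcol x = 0.
    by apply/colP => i; rewrite [RHS]mxE -(Zx i) /f -row_mul [RHS]mxE.
  by rewrite /f /proj -[v in LHS]mulmx1 -(subrK (G *m pinvmx G) 1%:M) -/D
    mulmxDr mulmxDl -mulmxA Dx mulmx0 add0r.
have [B B_le] := choice (fun i => (bmb i).2).
pose J v : R := \int[mu]_x `|f v x|.
have J_ge0 v : 0 <= J v by apply: Rintegral_ge0.
have vG_le v j : `|(v *m G) 0 j| <= `|B j| * J v.
  have bmfb := bounded_measurableM (bmf v) (bmb j).
  rewrite vGE (le_trans (le_normr_Rintegral _ _))//.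
    exact: bounded_measurable_integrable.
  have bmn := bounded_measurable_norm (bmf v).
  rewrite /J -RintegralZl//; last exact: bounded_measurable_integrable.
  apply: le_Rintegral => //.
  - by apply: bounded_measurable_integrable; exact: bounded_measurable_norm.
  - apply: bounded_measurable_integrable.
    exact: bounded_measurableM (bounded_measurable_cst _) bmn.
  - move=> x _; rewrite normrM mulrC ler_wpM2r//.
    by rewrite (le_trans (B_le j x))// ler_norm.
pose C := \sum_i \sum_j `|B j| * `|pinvmx G j i|.
have C_ge0 : 0 <= C by rewrite sumr_ge0// => i _; rewrite sumr_ge0// => j _; rewrite mulr_ge0.
have proj_le v : \sum_i `|proj v 0 i| <= C * J v.
  rewrite mulr_suml; apply: ler_sum => i _.
  rewrite /proj mulmxA mxE (le_trans (ler_norm_sum _ _ _))// mulr_suml.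
  by apply: ler_sum => j _; rewrite normrM mulrAC ler_wpM2r.
(* The [+ 1] keeps the denominator positive when [C = 0]. *)
pose delta := e / (C + 1).
have delta_gt0 : 0 < delta by rewrite divr_gt0// ltr_wpDl.
have [P [phi [mphi phi_osc]]] := small_oscillation_partition delta_gt0 bmb.
have f_osc v x y : Z x -> Z y -> phi x = phi y -> `|f v x - f v y| <= e * J v.
  move=> Zx Zy xy; rewrite (fZ v x Zx) (fZ v y Zy) !fE -sumrB.
  apply: le_trans (ler_norm_sum _ _ _) _.
  apply: le_trans (_ : delta * (C * J v) <= _).
    apply: le_trans (ler_wpM2l (ltW delta_gt0) (proj_le v)).
    rewrite mulr_sumr; apply: ler_sum => i _.
    by rewrite -mulrBr normrM mulrC ler_wpM2r// phi_osc.
  rewrite mulrA ler_wpM2r// /delta mulrAC ler_pdivrMr ?ltr_wpDl//.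
  by rewrite ler_wpM2l ?(ltW e_gt0)// lerDl.
pose A t := phi @^-1` [set t].
(* A cell of positive measure must meet the full-measure set [Z]; in a null cell the point is
   arbitrary and gets weight zero. *)
have pick_pt t : exists x, mu (A t) != 0%E -> phi x = t /\ Z x.
  have [At0|At_neq0] := eqVneq (mu (A t)) 0%E; first by exists point.
  apply: contrapT => none; move/eqP: At_neq0; apply.
  apply: (measure_negligible (mphi t)); apply: negligibleS aeZ => x Ax Zx.
  by apply: none; exists x.
have [pt ptP] := choice pick_pt.
pose p t := fine (mu (A t)).
exists P, pt, p; split=> [|t|c]; [|exact: fine_ge0|].
  by apply/card_gt0P; exists (phi point).
have [v fc] : exists v, forall x, \sum_i c i * b i x = f v x.
  by exists (\row_i c i) => x; rewrite fE; apply: eq_bigr => i _; rewrite mxE.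
under eq_bigr do rewrite fc.
under eq_Rintegral do rewrite fc.
rewrite -/(J v).
(* The step function whose integral is the discrete sum. *)
pose g x : R := \sum_t `|f v (pt t)| * \1_(A t) x.
have bmA t : bounded_measurable (\1_(A t) : T -> R) by exact: (bounded_measurable_indic (mphi t)).
have bmg : bounded_measurable g by exact: bounded_measurable_sum.
have gE x : g x = `|f v (pt (phi x))|.
  rewrite /g (bigD1 (phi x))//= indicE mem_set// mulr1 big1 ?addr0// => t tx.
  by rewrite indicE memNset ?mulr0// => /= xt; rewrite xt eqxx in tx.
have -> : \sum_t p t * `|f v (pt t)| = \int[mu]_x g x.
  rewrite Rintegral_sum//; apply: eq_bigr => t _; rewrite mulrC.
  congr (_ * _); rewrite /p /Rintegral (integral_indic mu measurableT (mphi t)).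
  by rewrite setIT.
have bmn := bounded_measurable_norm (bmf v).
rewrite /J -RintegralB//; try exact: bounded_measurable_integrable.
rewrite -/(J v).
apply: Rintegral_norm_le_ae; last 2 first.
- by rewrite mulr_ge0// ltW.
- have aeA : {ae mu, forall x t, phi x = t -> mu (A t) != 0%E}.
    apply: filter_forall => t.
    have [At0|_] := eqVneq (mu (A t)) 0%E; last by apply: aeW.
    exists (A t); split=> [|//|x /= nx]; first exact: mphi.
    by apply: contrapT => xt; apply: nx => /xt.
  apply: filterS2 aeZ aeA => x Zx /(_ _ erefl) /ptP[ptx Zpt].
  rewrite gE (le_trans (ler_dist_dist _ _))// f_osc//.
- under eq_fun do rewrite -mulN1r.
  exact: bounded_measurableD bmg (bounded_measurableM (bounded_measurable_cst _) bmn).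
Qed.

End BoundedMeasurable.

(** * Continuous functions on a compact set, and the choice of constants *)

Lemma continuous_bounded_measurable (S : topologicalType) (Omega : set S)
    (x0 : Omega) (R : realType) (f : Omega -> R) :
  cover_compact Omega -> continuous f ->
  bounded_measurable (f : borelType x0 -> R).
Proof.
move=> Omega_compact /continuousP f_cont; split.
  apply: (measurability (@RGenOpens.G R)); first exact: RGenOpens.measurableE.
  move=> _ [_ [x [y ->]] <-]; rewrite setTI; apply: sub_sigma_algebra.
  by apply: f_cont; exact: interval_open.
(* Compactness speaks of open covers in the ambient space, so the sets where [|f| < n], open in the
   subspace, are extended to ambient open sets. *)
have ext_open (n : nat) : exists V : set S,
    open V /\ set_val @^-1` V = f @^-1` [set y | `|y| < n%:R :> R].
  have [|V oV VE] := f_cont [set y : R | `|y| < n%:R]; last by exists V.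
  rewrite (_ : [set y | _] = `](- n%:R), n%:R[%classic); first exact: interval_open.
  by apply/seteqP; split=> y; rewrite /= in_itv/= ltr_norml.
have [V VP] := choice ext_open.
have [||D _ D_cover] := Omega_compact nat setT V.
- by move=> n _; have [] := VP n.
- move=> x Ox; exists (Num.bound `|f (SigSub (mem_set Ox))|) => //.
  have [_ /seteqP[_ /(_ (SigSub (mem_set Ox)))]] := VP (Num.bound `|f (SigSub (mem_set Ox))|).
  by apply; exact: archi_boundP.
exists (\sum_(n <- D) n%:R) => x.
have [n /= nD Vx] := D_cover (set_val x) (set_valP x).
have [_ /seteqP[/(_ x Vx) /= fx_lt _]] := VP n.
apply: (le_trans (ltW fx_lt)); rewrite (big_fsetD1 n)//= lerDl.
by rewrite sumr_ge0.
Qed.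

(** The two errors add up to [e + e (1 + e) <= 3 e]; [4 e] leaves room. *)
Lemma relative_error_trans (R : realType) (e J S0 S1 : R) :
  0 < e <= 1 -> 0 <= J -> `|S0 - J| <= e * J -> `|S1 - S0| <= e * S0 ->
  (1 - 4 * e) * J <= S1 <= (1 + 4 * e) * J.
Proof.
move=> /andP[e_gt0 e_le1] J_ge0.
rewrite !ler_norml => /andP[S0_ge S0_le] /andP[S1_ge S1_le].
have eJ_le : e * (e * J) <= e * J by rewrite ler_piMl// mulr_ge0// ltW.
have eS0_le : e * S0 <= e * (J + e * J) by rewrite ler_wpM2l ?(ltW e_gt0)//; lra.
by rewrite mulrDr in eS0_le; apply/andP; split; lra.
Qed.

Theorem corollary1p1 (R : realType) :
  exists C : R, 0 < C /\
  forall (d : nat) (Omega : set 'rV[R]_d), compact Omega ->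
  forall n : nat, (2 <= n)%N ->
  forall X : {pred (Omega -> R)},
    submod_closed X ->
    (forall f, f \in X -> continuous f) ->
    dim_le X n ->
  forall eps : R, 0 < eps < 1 ->
  forall (x0 : Omega) (mu : probability (borelType x0) R),
  exists m : nat,
    [/\ (0 < m)%N,
        m%:R <= C * eps ^- 2 * n%:R * ln n%:R &
        exists (xi : 'I_m -> Omega) (lambda : 'I_m -> R),
          (forall j, 0 <= lambda j) /\
          forall f, f \in X ->
            ((1 - eps)%:E * \int[mu]_x `|f x|%:E
               <= (\sum_(j < m) lambda j * `|f (xi j)|)%:E
             /\ (\sum_(j < m) lambda j * `|f (xi j)|)%:E
               <= (1 + eps)%:E * \int[mu]_x `|f x|%:E)%E].
Proof.
(* As [n >= 2], [ln 24 + 2 = a * ln 2 <= a * ln n], which absorbs the additive constants into the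
   logarithm. *)
pose a : R := (ln 24 + 2) / ln 2.
have ln2_gt0 : 0 < ln 2 :> R by rewrite ln_gt0// ltr1n.
have a_ge0 : 0 <= a.
  by rewrite divr_ge0 ?(ltW ln2_gt0)// addr_ge0// ln_ge0// ler1n.
(* The 16 comes from [e = eps / 4], and [(ln 2)^-1] pays for rounding [m0] up to an integer. *)
exists (128 * 24 * 16 * (1 + a) + (ln 2)^-1); split.
  by rewrite ltr_wpDl ?invr_gt0// mulr_ge0 ?mulr_ge0// addr_ge0.
move=> d Omega Omega_compact n n_ge2 X _ X_cont [k [k_le [b [bX _ b_span]]]].
move=> eps /andP[eps_gt0 eps_lt1] x0 mu.
pose e := eps / 4.
have e_gt0 : 0 < e by rewrite divr_gt0.
have e01 : 0 < e <= 1 by rewrite e_gt0/=; rewrite /e; lra.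
have bmb i : bounded_measurable (b i : borelType x0 -> R).
  apply: continuous_bounded_measurable; first by rewrite -compact_cover.
  exact: X_cont.
have [P [pt [p [P_gt0 p_ge0 pP]]]] := discretize_measure mu e_gt0 bmb.
(* Scaling rows by the masses makes the [l_1] norm of [A c] the discrete [L_1] norm. *)
pose A : 'M[R]_(#|P|, k) :=
  \matrix_(t, i) (p (enum_val t) * b i (pt (enum_val t))).
pose W : R := 24 * n%:R.
pose m0 := 128 * W * (ln W + 2) / e ^+ 2.
(* The successor gives both [0 < m] and the strict inequality [m0 < m]. *)
pose m := (Num.truncn m0).+1.
have n_ge2R : 2 <= n%:R :> R by rewrite ler_nat.
have W_gt0 : 0 < W by rewrite mulr_gt0// (lt_le_trans _ n_ge2R).
have lnW : ln W = ln 24 + ln n%:R.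
  by rewrite lnM ?posrE// (lt_le_trans _ n_ge2R).
have lnn_ge : ln 2 <= ln n%:R :> R.
  by rewrite ler_ln ?posrE// (lt_le_trans _ n_ge2R).
have lnW_ge0 : 0 <= ln W.
  by rewrite lnW addr_ge0 ?ln_ge0 ?ler1n// (leq_trans _ n_ge2).
have m0_ge0 : 0 <= m0.
  rewrite divr_ge0 ?sqr_ge0// mulr_ge0 ?addr_ge0//.
  by rewrite mulr_ge0// ltW.
have m_large : 128 * (24 * n%:R) * (ln (24 * n%:R) + 2) < e ^+ 2 * m%:R.
  by rewrite [ltRHS]mulrC -ltr_pdivrMr ?exprn_gt0//; exact: truncnS_gt.
have n_gt0 : (0 < n)%N by exact: leq_trans n_ge2.
have [I [s [s_ge0 sP]]] := matrix_subsample A P_gt0 k_le n_gt0 e01 m_large.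
exists m; split=> //.
  have m_le : m%:R <= m0 + 1.
    by rewrite -natr1 lerD2r; have /andP[] := truncn_itv m0_ge0.
  apply: le_trans m_le _.
  have lnn_gt0 : 0 < ln n%:R :> R by exact: lt_le_trans lnn_ge.
  rewrite -!mulrA mulrDl; apply: lerD.
    have -> : m0 = 128 * 24 * 16 * (eps ^- 2 * n%:R * (ln W + 2)).
      by rewrite /m0 /W /e; field; rewrite gt_eqF.
    rewrite -!mulrA !ler_wpM2l//.
    rewrite !(mulrCA (1 + a)) ler_wpM2l ?invr_ge0 ?sqr_ge0// ler_wpM2l//.
    have -> : ln W + 2 = ln n%:R + a * ln 2.
      by rewrite lnW /a divfK ?gt_eqF// addrAC addrC.
    by rewrite mulrDl mul1r lerD2l ler_wpM2l.
  rewrite ler_pdivlMl// mulr1 (le_trans lnn_ge)// mulrA ler_peMl ?(ltW lnn_gt0)//.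
  apply: mulr_ege1; last by rewrite (le_trans _ n_ge2R)// ler1n.
  by rewrite invf_ge1 ?exprn_gt0// expr_le1 ?ltW.
exists (fun j => pt (enum_val (I j))), (fun j => s (I j) * p (enum_val (I j))).
split=> [j|f /b_span[c ->]]; first by rewrite mulr_ge0.
have fE x : (\sum_i c i *: b i) x = \sum_i c i * b i x by rewrite fct_sumE.
under eq_integral do rewrite fE.
under eq_bigr do rewrite fE.
have bmf : bounded_measurable (fun x : borelType x0 => `|\sum_i c i * b i x|).
  by apply: bounded_measurable_norm; exact: bounded_measurable_sum.
rewrite integral_bounded_measurable// -!EFinM !lee_fin.
have := pP c; have := sP (\col_i c i).
set J := Rintegral _ _ _.
have AcE t : (A *m \col_i c i) t 0 =
    p (enum_val t) * \sum_i c i * b i (pt (enum_val t)).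
  by rewrite mxE mulr_sumr; apply: eq_bigr => i _; rewrite !mxE; ring.
have normAcE t : `|(A *m \col_i c i) t 0| =
    p (enum_val t) * `|\sum_i c i * b i (pt (enum_val t))|.
  by rewrite AcE normrM ger0_norm.
have -> : \sum_i `|(A *m \col_i c i) i 0| =
    \sum_t p t * `|\sum_i c i * b i (pt t)|.
  rewrite [RHS](big_enum_val (fun t => p t * `|\sum_i c i * b i (pt t)|)).
  by apply: eq_bigr => t _; rewrite normAcE.
have -> : \sum_j s (I j) * `|(A *m \col_i c i) (I j) 0| =
    \sum_j s (I j) * p (enum_val (I j)) *
      `|\sum_i c i * b i (pt (enum_val (I j)))|.
  by apply: eq_bigr => j _; rewrite normAcE mulrA.
have J_ge0 : 0 <= J by exact: Rintegral_ge0.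
move=> S1_near S0_near.
have := relative_error_trans e01 J_ge0 S0_near S1_near.
have -> : 4 * e = eps by rewrite /e mulrC divfK.
by move=> /andP[].
Qed.
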